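(* Let $Q\subseteq\mathbb{R}^n$ be a convex compact set, let $f$ be a convex function attaining its minimum over $Q$, and let $\psi_\delta$ be a $(\delta,L)$-model of $f$ with respect to $V$ at every point $y\in Q$. Let $\widetilde\delta>0$, let $x_0\in Q$, and let $x_*$ be a minimizer of $f$ over $Q$ nearest to $x_0$ in the sense of the Bregman divergence (i.e. minimizing $V[x_0](\cdot)$ among minimizers of $f$ on $Q$). Suppose $V[x_0](x_* )\le R^2$. Let $(x_k)_{k\ge 0}$ be generated by the gradient method $$x_{k+1}:={\arg\min_{x\in Q}}^{\widetilde\delta}\ \bigl\{\psi_\delta(x,x_k)+L\,V[x_k](x)\bigr\},\qquad k\ge 0,$$ and put $\bar x_N=\frac1N\sum_{k=0}^{N-1}x_{k+1}$. Then for every $N\ge 1$ $$f(\bar x_N)-f(x_* )\le \frac{LR^2}{N}+\widetilde\delta+\delta .$$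
   Context: Prox-function and Bregman divergence: $d:\mathbb{R}^n\to\mathbb{R}$ is continuous, convex and differentiable (not necessarily strongly convex) with $\min_{x\in\mathbb{R}^n} d(x)=0$, and $V[y](x):=d(x)-d(y)-\langle\nabla d(y),x-y\rangle$. $(\delta,L)$-model: a function $\psi_\delta(x,y)$, convex in $x\in Q$ with $\psi_\delta(x,x)=0$ for all $x\in Q$, is a $(\delta,L)$-model of $f$ at a point $y$ with respect to $V$ ($L,\delta>0$) if for all $x\in Q$ $$0\le f(x)-\bigl(f(y)+\psi_\delta(x,y)\bigr)\le L V[y](x)+\delta .$$ Inexact minimization: for a convex function $\phi$ on $Q$, the notation $\tilde x={\arg\min_{x\in Q}}^{\widetilde\delta}\phi(x)$ means that $\tilde x\in Q$ satisfies: if $\phi$ is smooth, $\max_{x\in Q}\langle\nabla\phi(\tilde x),\tilde x-x\rangle\le\widetilde\delta$; if $\phi$ is a general convex function, there exists $h\in\partial\phi(\tilde x)$ with $\langle h,x_*-\tilde x\rangle\ge-\widetilde\delta$, where $x_*$ is the fixed minimizer of $f$ on $Q$ considered in the statement. *)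

(* Defs.v *)
From mathcomp Require Import all_boot all_order all_algebra.
From mathcomp Require Import all_classical all_reals all_analysis.

Set Implicit Arguments.
Unset Strict Implicit.
Unset Printing Implicit Defensive.

Import Order.TTheory GRing.Theory Num.Theory.
Import numFieldNormedType.Exports.

Local Open Scope classical_set_scope.
Local Open Scope ring_scope.

Section BregmanGradient.
Context {R : realType} {n : nat}.
Notation V := 'rV[R]_n.

Definition dot (u v : V) : R := \sum_i u 0 i * v 0 i.

(* The vector of partial derivatives; it is only meaningful at points where
   [f] is differentiable. *)
Definition grad (f : V -> R^o) (x : V) : V :=
  \row_i 'D_(delta_mx 0 i) f x.

Definition argmin (A : set V) (g : V -> R) : set V :=
  [set x | A x /\ forall y, A y -> g x <= g y].

Definition prox_function (d : V -> R^o) : Prop :=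
  [/\ continuous d,
      convex_function [set: V] d,
      (forall x, differentiable d x) &
      (exists x, d x = 0) /\ (forall x, 0 <= d x)].

(* [bregman d y x] is V[y](x): the base point comes first. *)
Definition bregman (d : V -> R^o) (y x : V) : R :=
  d x - d y - dot (grad d y) (x - y).

Definition is_model (Q : set V) (d f : V -> R^o) (delta L : R)
    (psi : V -> V -> R^o) (y : V) : Prop :=
  [/\ convex_function Q (psi ^~ y),
      (forall x, Q x -> psi x x = 0) &
      forall x, Q x ->
        0 <= f x - (f y + psi x y) <= L * bregman d y x + delta].

(* [phi] is regarded as a function on Q, so subgradient inequalities are only
   required at points of Q. *)
Definition subdifferential (Q : set V) (phi : V -> R^o) (x : V) : set V :=
  [set h | forall z, Q z -> phi x + dot h (z - x) <= phi z].

(* The two disjuncts are the criteria for a smooth and for a general convex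
   [phi]; the second one refers to the fixed reference point [xstar].  A smooth
   convex function is in particular a general one, so the cases overlap. *)
Definition inexact_argmin (Q : set V) (xstar : V) (tol : R)
    (phi : V -> R^o) (x : V) : Prop :=
  Q x /\
  (((forall z, Q z -> differentiable phi z) /\
    (forall z, Q z -> dot (grad phi x) (x - z) <= tol)) \/
   (exists2 h, subdifferential Q phi x h & - tol <= dot h (xstar - x))).

End BregmanGradient.

(* Main.v *)
Require Import Defs.
From mathcomp Require Import all_boot all_order all_algebra.
From mathcomp Require Import all_classical all_reals all_analysis.
From mathcomp Require Import ring lra.

Import Order.TTheory GRing.Theory Num.Theory.
Import numFieldNormedType.Exports.

Local Open Scope classical_set_scope.
Local Open Scope ring_scope.

(** Write [V[y](x)] for [bregman d y x] and [psi(z, x)] for the model at [x].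
    One step of the method satisfies, for [x = x_k], [x' = x_(k+1)] and
    the minimizer [xs], the three-point inequality
      [psi(x', x) + L V[x](x') + L V[x'](xs)
         <= psi(xs, x) + L V[x](xs) + tdelta]
    ([inexact_argmin_three_points]).  It comes from a first-order comparison at
    [x'] in the direction [xs - x']: the approximate optimality of [x'] says
    that the objective [psi(., x) + L V[x]] has slope at least [- tdelta] in
    that direction; the Bregman part has a derivative there because [d] is
    differentiable; and the slope of the remaining part [psi(., x)], which need
    not be differentiable, is at most [psi(xs, x) - psi(x', x)] by convexity
    ([convex_sum_first_order]).  The derivative of [V[x]] at [x'] along
    [xs - x'] is [dot (grad d x' - grad d x) (xs - x')], which equals
    [V[x](xs) - V[x](x') - V[x'](xs)].

    The upper model bound at [x'] and the lower model bound at [xs] turn this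
    into
      [f(x') - f(xs) <= L V[x](xs) - L V[x'](xs) + tdelta + delta].
    Summing over [k < N] telescopes; the last Bregman term is nonnegative by
    convexity of [d] ([bregman_ge0]), the first is at most [L r^2], and the
    value of [f] at the mean is at most the mean of its values
    ([convex_mean]).

    All first-order arguments use one-sided difference quotients along
    segments.  On a segment with endpoints in [Q] the points with parameter in
    ]0, 1] stay in [Q], which is all that subgradients relative to [Q] and
    convexity on [Q] give access to. *)

Section DotProduct.
Context {R : realType} {n : nat}.
Implicit Types (u v w : 'rV[R]_n) (a : R).

Lemma dotDr u v w : dot u (v + w) = dot u v + dot u w.
Proof. by rewrite -big_split; apply: eq_bigr => i _; rewrite mxE mulrDr. Qed.

Lemma dotZr a u v : dot u (a *: v) = a * dot u v.
Proof. by rewrite big_distrr; apply: eq_bigr => i _; rewrite mxE mulrCA. Qed.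

Lemma dotNr u v : dot u (- v) = - dot u v.
Proof. by rewrite -scaleN1r dotZr mulN1r. Qed.

End DotProduct.

Section DirectionalDerivative.
Context {R : realType} {n : nat}.
Local Notation V := 'rV[R]_n.
Implicit Types (Q : set V) (g psi s d : V -> R^o) (x y z v : V).

Definition diffquot g x v (t : R) : R := t^-1 * (g (t *: v + x) - g x).

Lemma derive_dot_grad g x v :
  differentiable g x -> 'D_v g x = dot (grad g x) v.
Proof.
move=> dg; rewrite deriveE// [in LHS](row_sum_delta v) linear_sum.
by apply: eq_bigr => i _; rewrite linearZ mxE deriveE// mulrC.
Qed.

(** The limit is one-sided because, from a boundary point of a convex set,
    only nonnegative parameters lead into the set. *)
Lemma diffquot_cvg g x v : differentiable g x ->
  diffquot g x v t @[t --> 0^'+] --> dot (grad g x) v.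
Proof.
move=> dg; rewrite -derive_dot_grad//.
by apply: cvg_dnbhs_at_right; exact: (diff_derivable dg).
Qed.

Lemma segment_mem Q x z t : convex_set Q -> Q x -> Q z -> 0 < t <= 1 ->
  Q (t *: (z - x) + x).
Proof.
move=> cQ Qx Qz /andP[/ltW t0 t1].
have := cQ z x (Itv01 t0 t1) (mem_set Qz) (mem_set Qx).
rewrite inE; congr Q; rewrite /conv/=/unstable.onem.
by rewrite scalerBr scalerBl scale1r addrA addrAC.
Qed.

(** Difference quotients of a convex function increase with the step, and the
    right-hand side is the one for step 1. *)
Lemma convex_diffquot_le Q g x z t : convex_function Q g -> Q x -> Q z ->
  0 < t <= 1 -> diffquot g x (z - x) t <= g z - g x.
Proof.
move=> cg Qx Qz /andP[t0 t1].
have := cg (Itv01 (ltW t0) t1) z x (mem_set Qz) (mem_set Qx).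
rewrite convRE /= /unstable.onem /conv/= /unstable.onem => h.
rewrite /diffquot ler_pdivrMl// lerBlDr.
rewrite scalerBr -addrA [_ + x]addrC -[X in X - _ *: _]scale1r -scalerBl.
apply: le_trans h _; lra.
Qed.

Lemma near_right_unit : \forall t \near (0 : R)^'+, 0 < t <= 1.
Proof.
near=> t; apply/andP; split; near: t; first exact: nbhs_right_gt.
exact: nbhs_right_le.
Unshelve. all: by end_near. Qed.

Lemma convex_grad_le d x z : convex_function [set: V] d ->
  differentiable d x -> d x + dot (grad d x) (z - x) <= d z.
Proof.
move=> cd dd; rewrite -lerBrDl.
apply: (ler_cvg_to (diffquot_cvg _ _ (z - x) dd) (cvg_cst (d z - d x))).
near=> t; apply: (@convex_diffquot_le [set: V]) => //.
by near: t; exact: near_right_unit.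
Unshelve. all: by end_near. Qed.

(** The convex part [psi] may have no directional derivative that can be
    computed from the data, so its quotient is replaced by the bound
    [psi z - psi x] before passing to the limit.  The lower bound [u] is a
    function of the step rather than a constant so that it can be the quotient
    of [psi \+ s] itself when this sum is differentiable. *)
Lemma convex_sum_first_order {Q psi s x z} {u : R -> R} {a c : R} :
  convex_function Q psi -> Q x -> Q z ->
  (\forall t \near 0^'+, u t <= diffquot (psi \+ s) x (z - x) t) ->
  u t @[t --> 0^'+] --> c -> diffquot s x (z - x) t @[t --> 0^'+] --> a ->
  c <= psi z - psi x + a.
Proof.
move=> cpsi Qx Qz uq uc sa; rewrite -lerBlDl.
apply: (ler_cvg_to (cvgB uc (cvg_cst (psi z - psi x))) sa).
near=> t.
have t01 : 0 < t <= 1 by near: t; exact: near_right_unit.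
have := convex_diffquot_le Q psi x z t cpsi Qx Qz t01.
have : u t <= diffquot (psi \+ s) x (z - x) t by near: t.
rewrite /diffquot /= !fctE; lra.
Unshelve. all: by end_near. Qed.

Lemma bregman_ge0 d y x : prox_function d -> 0 <= bregman d y x.
Proof.
case=> _ cd dd _; rewrite /bregman.
have := convex_grad_le d y x cd (dd y); lra.
Qed.

(** [bregman d y] differs from [d] by an affine map with linear part
    [- dot (grad d y)]. *)
Lemma bregman_diffquot_cvg d y x v : differentiable d x ->
  diffquot (bregman d y) x v t @[t --> 0^'+] -->
  dot (grad d x) v - dot (grad d y) v.
Proof.
move=> dd.
apply: (@cvg_trans _ ((diffquot d x v t - dot (grad d y) v) @[t --> 0^'+])).
  apply: near_eq_cvg; near=> t.
  have t0 : 0 < t by near: t; exact: nbhs_right_gt.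
  rewrite /diffquot /bregman !dotDr dotZr; field; exact: lt0r_neq0.
by apply: cvgB; [exact: diffquot_cvg|exact: cvg_cst].
Unshelve. all: by end_near. Qed.

(** A common form for the two criteria: towards [xs] the slope of [phi] is
    asymptotically at least [- tol].  For a differentiable [phi] the bound [u]
    is the difference quotient itself; for a subgradient [h] it is the constant
    [dot h (xs - x)], below every quotient. *)
Lemma inexact_argmin_diffquot {Q xs tol phi x} :
  convex_set Q -> Q xs -> inexact_argmin Q xs tol phi x ->
  exists (u : R -> R) (c : R),
   [/\ - tol <= c, u t @[t --> 0^'+] --> c &
    \forall t \near 0^'+, u t <= diffquot phi x (xs - x) t].
Proof.
move=> cQ Qxs [Qx [[dphi opt]|[h sub opt]]].
  exists (diffquot phi x (xs - x)), (dot (grad phi x) (xs - x)); split.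
  - by rewrite lerNl -dotNr opprB opt.
  - exact/diffquot_cvg/dphi.
  - by near=> t.
exists (cst (dot h (xs - x))), (dot h (xs - x)); split => //.
  exact: cvg_cst.
near=> t; have t01 : 0 < t <= 1 by near: t; exact: near_right_unit.
have /andP[t0 _] := t01.
have := sub _ (segment_mem _ _ _ _ cQ Qx Qxs t01).
rewrite addrK dotZr /diffquot => sub'.
by rewrite /cst ler_pdivlMl//; lra.
Unshelve. all: by end_near. Qed.

(** After the first-order comparison at [x] what remains is the identity
    [dot (grad d x - grad d y) (xs - x)
       = V[y](xs) - V[y](x) - V[x](xs)]. *)
Lemma inexact_argmin_three_points {Q d L tol psi y x xs} :
  differentiable d x -> convex_set Q -> convex_function Q psi -> Q xs ->
  inexact_argmin Q xs tol (fun z => psi z + L * bregman d y z) x ->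
  psi x + L * bregman d y x + L * bregman d x xs <=
  psi xs + L * bregman d y xs + tol.
Proof.
move=> dd cQ cpsi Qxs opt; have Qx := opt.1.
have [u [c [tolc uc uq]]] := inexact_argmin_diffquot cQ Qxs opt.
have sa : diffquot (fun z => L * bregman d y z) x (xs - x) t @[t --> 0^'+] -->
    L * (dot (grad d x) (xs - x) - dot (grad d y) (xs - x)).
  rewrite (_ : diffquot _ _ _ =
      fun t => L * diffquot (bregman d y) x (xs - x) t).
    by apply: cvgM; [exact: cvg_cst|exact: bregman_diffquot_cvg].
  by apply/funext => t; rewrite /diffquot -mulrBr mulrCA.
have := convex_sum_first_order cpsi Qx Qxs uq uc sa.
rewrite /bregman.
(* the three-point identity splits [xs - y] at [x] *)
have -> : dot (grad d y) (xs - y) =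
    dot (grad d y) (xs - x) + dot (grad d y) (x - y).
  by rewrite -dotDr addrA subrK.
move=> H; rewrite -subr_ge0; lra.
Qed.

End DirectionalDerivative.

(** Induction on the number of points: the mean of [m + 2] points is the convex
    combination, with weight [1 / (m + 2)] on the last point, of that point and
    the mean of the others.  Membership in [Q] is proved along with the
    inequality because convexity of [f] applies only to points of [Q]. *)
Lemma convex_mean {R : realType} {n : nat} {Q : set 'rV[R]_n}
    {f : 'rV[R]_n -> R^o} {p : nat -> 'rV[R]_n} (m : nat) :
  convex_set Q -> convex_function Q f -> (forall k, Q (p k)) ->
  Q (m.+1%:R^-1 *: \sum_(k < m.+1) p k) /\
  f (m.+1%:R^-1 *: \sum_(k < m.+1) p k) <=
    m.+1%:R^-1 * \sum_(k < m.+1) f (p k).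
Proof.
move=> cQ cf Qp; elim: m => [|m [IHQ IHf]].
  by rewrite !big_ord1 invr1 scale1r mul1r.
have t0 : 0 <= m.+2%:R^-1 :> R by rewrite invr_ge0.
have t1 : m.+2%:R^-1 <= 1 :> R by rewrite invf_le1// ler1n.
have m1 : m.+1%:R != 0 :> R by rewrite pnatr_eq0.
have m2 : m.+2%:R != 0 :> R by rewrite pnatr_eq0.
have tE : 1 - m.+2%:R^-1 = m.+1%:R / m.+2%:R :> R.
  by rewrite -[X in X - _](divff m2) -[X in _ - X]mul1r -mulrBl -natr1 addrK.
have := cf (Itv01 t0 t1) _ _ (mem_set (Qp m.+1)) (mem_set IHQ).
have := cQ _ _ (Itv01 t0 t1) (mem_set (Qp m.+1)) (mem_set IHQ).
rewrite convRE /conv /= /unstable.onem tE scalerA mulrAC divff// mul1r.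
rewrite -scalerDr inE [p _ + _]addrC ![\sum_(k < m.+2) _]big_ord_recr /=.
move=> QS fS; split => //; apply: le_trans fS _; rewrite mulrDr addrC lerD2r.
rewrite [_ / _]mulrC -mulrA ler_wpM2l//.
by rewrite mulrC -ler_pdivlMr ?ltr0n// mulrC.
Qed.

Theorem theorem1 (R : realType) (n : nat) (d : 'rV[R]_n -> R^o)
    (Q : set 'rV[R]_n) (f : 'rV[R]_n -> R^o) (L delta tdelta r : R)
    (psi : 'rV[R]_n -> 'rV[R]_n -> R^o)
    (x : nat -> 'rV[R]_n) (xstar : 'rV[R]_n)
    (hd : prox_function d)
    (Qconvex : convex_set Q) (Qcompact : compact Q)
    (fconvex : convex_function Q f)
    (L0 : 0 < L) (delta0 : 0 < delta) (tdelta0 : 0 < tdelta)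
    (hpsi : forall y, Q y -> is_model Q d f delta L psi y)
    (Qx0 : Q (x 0%N))
    (hxstar : argmin (argmin Q f) (bregman d (x 0%N)) xstar)
    (hr : bregman d (x 0%N) xstar <= r ^+ 2)
    (hx : forall k : nat,
      inexact_argmin Q xstar tdelta
        (fun z => psi z (x k) + L * bregman d (x k) z) (x k.+1))
    (N : nat) (N0 : (0 < N)%N) :
  f (N%:R^-1 *: \sum_(k < N) x k.+1) - f xstar
    <= L * r ^+ 2 / N%:R + tdelta + delta.
Proof.
have Qxs : Q xstar by case: hxstar => -[].
have Qx k : Q (x k) by case: k => [//|k]; have [] := hx k.
have step k : f (x k.+1) - (f xstar + tdelta + delta) <=
    L * bregman d (x k) xstar - L * bregman d (x k.+1) xstar.
  have [cpsi _ model] := hpsi _ (Qx k); have [_ _ dd _] := hd.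
  have := inexact_argmin_three_points (dd _) Qconvex cpsi Qxs (hx k).
  have /andP[_] := model _ (Qx k.+1); have /andP[+ _] := model _ Qxs.
  lra.
have tele m : \sum_(k < m) (f (x k.+1) - (f xstar + tdelta + delta)) <=
    L * bregman d (x 0%N) xstar - L * bregman d (x m) xstar.
  elim: m => [|m IH]; first by rewrite big_ord0 subrr.
  rewrite big_ord_recr /=; move: IH (step m); lra.
case: N N0 => // N _.
have [_ mean] := convex_mean N Qconvex fconvex (fun k => Qx k.+1).
rewrite -addrA -lerBlDr -addrA -opprD addrA.
apply: (@le_trans _ _ (N.+1%:R^-1 *
    \sum_(k < N.+1) (f (x k.+1) - (f xstar + tdelta + delta)))).
  rewrite sumrB sumr_const card_ord -[(_ + _) *+ _]mulr_natl mulrBr.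
  by rewrite mulKf ?pnatr_eq0// lerB.
rewrite [leRHS]mulrC ler_wpM2l ?invr_ge0//.
apply: le_trans (tele _) _; rewrite lerBlDr; apply: ler_wpDr.
  by rewrite mulr_ge0 ?bregman_ge0 ?ltW.
by rewrite ler_wpM2l// ltW.
Qed.
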